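(* For any three continuous functions $f_1,f_2,f_3:\mathrm{SO}(3)\to S^3$, there exists a rotation $R\in\mathrm{SO}(3)$ such that $d(R,\mathbf{R}_Q(f_i(R)))=\pi$ for all $i\in\{1,2,3\}$.
   Context: $S^3$ is the set of unit quaternions, identifying $w+x\mathbf{i}+y\mathbf{j}+z\mathbf{k}$ with $(w,x,y,z)$. $\mathbf{R}_Q:S^3\to\mathrm{SO}(3)$ is the standard conversion $$\mathbf{R}_Q(w,x,y,z)=\begin{bmatrix}1-2y^2-2z^2 & 2(xy-zw) & 2(xz+yw)\\ 2(xy+zw) & 1-2x^2-2z^2 & 2(yz-xw)\\ 2(xz-yw) & 2(yz+xw) & 1-2x^2-2y^2\end{bmatrix}.$$ For $R_1,R_2\in\mathrm{SO}(3)$, $d(R_1,R_2)=\cos^{-1}\frac{\mathrm{tr}(R_2R_1^{-1})-1}{2}$ is the angle of the rotation $R_2R_1^{-1}$. *)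

(* Defs.v *)
From HB Require Import structures.
From mathcomp Require Import all_boot all_order all_algebra.
From mathcomp Require Import all_classical all_reals all_analysis.
Set Implicit Arguments. Unset Strict Implicit. Unset Printing Implicit Defensive.
Import Order.TTheory GRing.Theory Num.Theory.
Import numFieldTopology.Exports numFieldNormedType.Exports.
Local Open Scope ring_scope.
Local Open Scope classical_set_scope.

Definition SO3 {R : realType} : set 'M[R]_3 :=
  [set M | M *m M^T = 1%:M /\ \det M = 1].

(* S^3: unit quaternions w + x i + y j + z k, encoded as the row vector
   (w, x, y, z) in R^4 (indices 0,1,2,3). *)
Definition S3 {R : realType} : set 'rV[R]_4 :=
  [set q | \sum_(i < 4) q ord0 i ^+ 2 = 1].

Definition qw {R : realType} (q : 'rV[R]_4) : R := q ord0 (@Ordinal 4 0 isT).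
Definition qx {R : realType} (q : 'rV[R]_4) : R := q ord0 (@Ordinal 4 1 isT).
Definition qy {R : realType} (q : 'rV[R]_4) : R := q ord0 (@Ordinal 4 2 isT).
Definition qz {R : realType} (q : 'rV[R]_4) : R := q ord0 (@Ordinal 4 3 isT).

Definition RQ {R : realType} (q : 'rV[R]_4) : 'M[R]_3 :=
  let w := qw q in let x := qx q in let y := qy q in let z := qz q in
  \matrix_(i < 3, j < 3)
    nth 0 (nth [::]
      [:: [:: 1 - 2 * y ^+ 2 - 2 * z ^+ 2; 2 * (x * y - z * w); 2 * (x * z + y * w)];
          [:: 2 * (x * y + z * w); 1 - 2 * x ^+ 2 - 2 * z ^+ 2; 2 * (y * z - x * w)];
          [:: 2 * (x * z - y * w); 2 * (y * z + x * w); 1 - 2 * x ^+ 2 - 2 * y ^+ 2]]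
      i) j.

Definition rot_dist {R : realType} (R1 R2 : 'M[R]_3) : R :=
  acos ((\tr (R2 *m invmx R1) - 1) / 2).

(* Main.v *)
(** Writing R = RQ q, the angle between RQ q and RQ p is pi exactly when q and p
    are orthogonal, and h_i(q) := <q, f_i(RQ q)> is odd because RQ (- q) = RQ q.
    So it suffices that three odd continuous functions on the 3-sphere have a
    common zero, which is the Borsuk-Ulam theorem.

    Borsuk-Ulam is obtained by a mod 2 cochain argument.  On the sphere of
    dimension n, let c_k be the upper k-dimensional hemisphere of an iterated
    barycentric subdivision of the boundary of the cross-polytope, so that
    d c_(k+1) = c_k + (-c_k).  Let a_i be an odd sign of h_i.  As a_i(v) + a_i(-v)
    = 1 and da_i is invariant under the antipody, the numbers
    <da_k u ... u da_1, c_k> all equal <1, c_0> = 1 mod 2.  Hence some simplex of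
    the subdivision has, for each i <= n, an edge along which h_i changes sign;
    refining the subdivision and using compactness yields the common zero. *)
Require Import Defs.
From HB Require Import structures.
From mathcomp Require Import all_boot all_order all_algebra.
From mathcomp Require Import ring lra.
From mathcomp Require Import all_classical all_reals all_analysis.
Import Order.TTheory GRing.Theory Num.Theory.
Import numFieldTopology.Exports numFieldNormedType.Exports.
Local Open Scope ring_scope.
Local Open Scope classical_set_scope.

Set Implicit Arguments.
Unset Strict Implicit.

(** * Cochains mod 2 *)

Section Cochains.
Variable T : eqType.
Implicit Types (f g : seq T -> bool) (s : seq T).

(* A mod 2 cochain, of all degrees at once, is a boolean function on arbitrary
   vertex sequences, the degenerate ones and the empty one included; chains
   only appear through the cochains they evaluate. *)
Fixpoint cobd f s : bool :=
  if s is v :: s' then f s' (+) cobd (fun t => f (v :: t)) s' else false.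

Lemma eq_cobd f g s :
    (forall t, (size t).+1 = size s -> {subset t <= s} -> f t = g t) ->
  cobd f s = cobd g s.
Proof.
elim: s f g => [//|v s IH] f g fg /=; congr (_ (+) _).
  by apply: fg => // x xs; rewrite in_cons xs orbT.
apply: IH => t st ts; apply: fg; first by rewrite /= st.
by move=> x; rewrite !in_cons => /orP[->//|/ts ->]; rewrite orbT.
Qed.

Lemma cobdD f g s : cobd (fun t => f t (+) g t) s = cobd f s (+) cobd g s.
Proof. by elim: s f g => [//|v s IH] f g /=; rewrite IH addbACA. Qed.

Lemma cobd_false s : cobd (fun=> false) s = false.
Proof. by elim: s. Qed.

Lemma cobd_cobd f s : cobd (cobd f) s = false.
Proof.
elim: s f => [//|v s IH] f /=.
by rewrite cobdD IH addbF addbb.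
Qed.

Lemma cobd_map (h : T -> T) f s :
  cobd f (map h s) = cobd (fun t => f (map h t)) s.
Proof. by elim: s f => [//|v s IH] f /=; rewrite IH. Qed.

Definition cup0 (a : T -> bool) f s : bool :=
  if s is v :: _ then a v && f s else false.

(* The cup product of the coboundaries of the 0-cochains in [ss]. *)
Fixpoint signcup (ss : seq (T -> bool)) s : bool :=
  match ss, s with
  | [::], [:: _] => true
  | a :: ss', v :: ((v' :: _) as s') => (a v (+) a v') && signcup ss' s'
  | _, _ => false
  end.

Lemma signcup_nil ss : signcup ss [::] = false.
Proof. by case: ss. Qed.

(** Leibniz rule with [f] closed: d(a u f) = da u f. Cochains are augmented, as [cobd f [:: v] = f
    [::]], so [f [::] = false] is what settles the one-vertex case. *)
Lemma cobd_cup0 a f s : f [::] = false -> cobd f =1 (fun=> false) ->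
  cobd (cup0 a f) s =
  if s is v :: ((v' :: _) as s') then (a v (+) a v') && f s' else false.
Proof.
move=> f0 df; case: s => [//|v s] /=.
have -> : cobd (fun t => a v && f (v :: t)) s = a v && f s.
  case: (a v) => /=; last by rewrite cobd_false.
  by move: (df (v :: s)) => /=; case: (f s); case: (cobd _ s).
case: s => [|v' s]; first by rewrite /= f0 andbF.
by rewrite /=; case: (a v); case: (a v'); case: (f _).
Qed.

(** For nonempty [ss] the cochain is itself a coboundary, by the Leibniz rule; for [[::]] it is 1 on
    each vertex, and an edge has two ends. *)
Lemma cobd_signcup ss : cobd (signcup ss) =1 (fun=> false).
Proof.
elim: ss => [|a ss IH] s; last first.
  rewrite -(cobd_cobd (cup0 a (signcup ss)) s); congr (cobd _ s).
  by apply/funext => t; rewrite cobd_cup0// signcup_nil.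
case: s => [//|v [//|v' s]] /=.
by rewrite cobd_false addbF; case: s.
Qed.

Lemma cobd_cup0_signcup a ss : cobd (cup0 a (signcup ss)) = signcup (a :: ss).
Proof.
apply/funext => s; rewrite cobd_cup0 ?signcup_nil//; exact: cobd_signcup.
Qed.

Lemma signcup_sign_change (I : eqType) (a : I -> T -> bool) (js : seq I) s i :
  i \in js -> signcup (map a js) s ->
  exists x y, [/\ x \in s, y \in s & a i x != a i y].
Proof.
elim: js s => [//|j js IH] [|v [|v' s]]//.
rewrite in_cons => /predU1P[-> /= /andP[av _]|ijs /= /andP[_ ws]].
  exists v, v'; rewrite !in_cons !eqxx orbT; split => //.
  by move: av; case: (a j v); case: (a j v').
have [x [y [xs ys xy]]] := IH _ ijs ws.
by exists x, y; rewrite in_cons xs orbT in_cons ys orbT.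
Qed.

End Cochains.

(** * Antipody and hemispheres *)

Section Antipodal.
Variable V : zmodType.
Implicit Types (f g : seq V -> bool) (s : seq V) (ss : seq (V -> bool)).

Definition antip f s := f (map -%R s).

Lemma map_oppK : involutive (map (-%R : V -> V)).
Proof. exact: mapK (@opprK V). Qed.

Lemma antipK : involutive antip.
Proof. by move=> f; apply/funext => s; rewrite /antip map_oppK. Qed.

Lemma cobd_antip f : cobd (antip f) = antip (cobd f).
Proof. by apply/funext => s; rewrite /antip cobd_map. Qed.

Lemma antip_signcup ss s :
    {in s, forall v, all (fun a : V -> bool => a (- v) == ~~ a v) ss} ->
  antip (signcup ss) s = signcup ss s.
Proof.
elim: ss s => [|a ss IH] [|v [|v' s]]// as_.
rewrite /antip /=; have := as_ v; have := as_ v'.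
rewrite !in_cons !eqxx orbT => /(_ isT)/= /andP[/eqP-> _] /(_ isT)/= /andP[/eqP-> _].
congr (_ && _); first by case: (a v); case: (a v').
rewrite -[RHS]IH// => x xs.
by have := as_ x; rewrite in_cons xs orbT => /(_ isT)/= /andP[].
Qed.

(** Oddness makes the two values of [a] at the first vertex add up to 1, while [signcup ss] is
    invariant: symmetrising strips off the factor [a]. *)
Lemma antip_cup0 a ss s :
    {in s, forall v, all (fun a : V -> bool => a (- v) == ~~ a v) (a :: ss)} ->
  cup0 a (signcup ss) s (+) antip (cup0 a (signcup ss)) s = signcup ss s.
Proof.
case: s => [_|v s as_]; first by rewrite /antip/= signcup_nil.
rewrite {2}/cup0 /antip /=.
have /= /andP[/eqP-> _] := as_ v (mem_head _ _).
have -> : signcup ss (- v :: map -%R s) = signcup ss (v :: s).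
  by apply: (@antip_signcup ss (v :: s)) => x /as_ /= /andP[].
by case: (a v); case: (signcup _ _).
Qed.

(* [hemi e0 [:: e_k; ...; e_1]] evaluates a cochain on the upper half of the
   boundary of the cross-polytope on [e0, e_1, ..., e_k], seen as the cone
   with apex [e_k] over the whole sphere of dimension [k - 1]. *)
Fixpoint hemi (e0 : V) (es : seq V) f : bool :=
  if es is e :: es' then
    let g := fun s => f (e :: s) in hemi e0 es' g (+) hemi e0 es' (antip g)
  else f [:: e0].

Lemma hemiD e0 es f g :
  hemi e0 es (fun s => f s (+) g s) = hemi e0 es f (+) hemi e0 es g.
Proof.
elim: es f g => [//|e es IH] f g /=.
by rewrite -addbACA -!IH.
Qed.

Lemma hemi_false e0 es : hemi e0 es (fun=> false) = false.
Proof. by elim: es => [//|e es IH] /=; rewrite /antip IH. Qed.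

(** Stokes: a hemisphere is bounded by the whole sphere one dimension lower. The boundary of the
    cone from [e] is its base plus the cone over the boundary of the base; the latter cancels, since
    the two halves of the base have the same boundary. *)
Lemma hemi_cobd e0 e es f :
  hemi e0 (e :: es) (cobd f) = hemi e0 es f (+) hemi e0 es (antip f).
Proof.
elim: es e f => [|e' es IH] e f.
  by rewrite /= /antip /=; case: (f [:: e0]); case: (f [:: - e0]); case: (f [:: e]).
set es1 := e' :: es.
have hemi_cons F : hemi e0 (e :: es1) F =
  hemi e0 es1 (fun s => F (e :: s)) (+) hemi e0 es1 (antip (fun s => F (e :: s))).
  by [].
set g := fun s => f (e :: s); rewrite hemi_cons.
have -> : antip (fun s => cobd f (e :: s)) =
    (fun s => antip f s (+) cobd (antip g) s).
  by apply/funext => s; rewrite cobd_antip.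
rewrite (hemiD _ _ f (cobd g)) hemiD !IH antipK.
by rewrite [X in _ (+) (_ (+) X)]addbC addbACA addbb addbF.
Qed.

Section Support.
Variables (I : eqType) (e : I -> V).

Definition vertices (eps : I -> bool) (js : seq I) : seq V :=
  [seq if eps j then - e j else e j | j <- js].

(** Reduces evaluations on a hemisphere to single facets, where convexity is available. *)
Lemma eq_hemi j0 js f g : uniq (rcons js j0) ->
    (forall eps, f (vertices eps (rcons js j0)) = g (vertices eps (rcons js j0))) ->
  hemi (e j0) (map e js) f = hemi (e j0) (map e js) g.
Proof.
elim: js f g => [|j js IH] f g /=; first by move=> _ /(_ xpred0).
move=> /andP[jjs ujs] fg.
(* The apex is always [+ e j], so the sign at [j] is reset; as [j] does not recur, the other signs
   are unaffected. *)
have vE eps : e j :: vertices eps (rcons js j0) =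
    vertices (fun i => (i != j) && eps i) (j :: rcons js j0).
  rewrite /vertices /= eqxx /=; congr (_ :: _).
  by apply/eq_in_map => i ijs; case: eqP ijs jjs => [-> ->|].
congr (_ (+) _); apply: IH => // eps; first by rewrite vE fg.
rewrite /antip.
have -> : map -%R (vertices eps (rcons js j0)) =
    vertices (fun i => ~~ eps i) (rcons js j0).
  rewrite /vertices -map_comp; apply: eq_map => i /=.
  by case: (eps i) => //=; rewrite opprK.
by rewrite vE fg.
Qed.
End Support.
End Antipodal.

(** * Barycentric subdivision *)

Section Subdivision.
Variables (R : realType) (V : normedModType R).
Implicit Types (f g : seq V -> bool) (s t : seq V).

Definition barycenter s : V := (size s)%:R^-1 *: \sum_(v <- s) v.

(* Transpose of barycentric subdivision, which sends a simplex to the cone from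
   its barycenter over the subdivision of its boundary. *)
Fixpoint subdivn n f s : bool :=
  if n is m.+1 then cobd (subdivn m (fun t => f (barycenter s :: t))) s
  else f [::].

(** The size is the fuel of [subdivn]: structural recursion does not see that faces are shorter. *)
Definition subdiv f s := subdivn (size s) f s.

Lemma subdivnD n f g s :
  subdivn n (fun t => f t (+) g t) s = subdivn n f s (+) subdivn n g s.
Proof.
elim: n f g s => [//|n IH] f g s /=.
by rewrite -cobdD; apply: eq_cobd => t _ _; rewrite IH.
Qed.

(** Subdivision is a chain map. Evaluating [cobd f] on a cone gives [f] on the base plus a
    coboundary on the base; by induction the latter contributes a double coboundary, which
    vanishes. *)
Lemma cobd_subdivn n f s : size s = n.+1 ->
  cobd (subdivn n f) s = subdivn n.+1 (cobd f) s.
Proof.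
elim: n f s => [|n IH] f s sn.
  by case: s sn => [|v []]//= _; rewrite !addbF.
rewrite -[RHS]/(cobd (subdivn n.+1 (fun t => f t (+) cobd
  (fun u => f (barycenter s :: u)) t)) s).
transitivity (cobd (fun t => subdivn n.+1 f t (+)
    cobd (subdivn n (fun u => f (barycenter s :: u))) t) s).
  by rewrite cobdD cobd_cobd addbF.
apply: eq_cobd => t; rewrite sn => -[tn] _.
by rewrite IH// subdivnD.
Qed.

Lemma cobd_subdiv f : cobd (subdiv f) = subdiv (cobd f).
Proof.
apply/funext => s; rewrite /subdiv; case sn: (size s) => [|n].
  by case: s sn.
rewrite -cobd_subdivn//; apply: eq_cobd => t; rewrite sn => -[->] //.
Qed.

Lemma barycenterN s : barycenter (map -%R s) = - barycenter s.
Proof. by rewrite /barycenter size_map big_map sumrN scalerN. Qed.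

Lemma subdivn_opp n f s :
  subdivn n f (map -%R s) = subdivn n (antip f) s.
Proof.
elim: n f s => [//|n IH] f s /=; rewrite cobd_map.
by apply: eq_cobd => t _ _; rewrite IH barycenterN /antip /=.
Qed.

Lemma subdiv_antip f : subdiv (antip f) = antip (subdiv f).
Proof. by apply/funext => s; rewrite /antip /subdiv size_map subdivn_opp. Qed.

Lemma iter_cobd_subdiv m f : cobd (iter m subdiv f) = iter m subdiv (cobd f).
Proof. by elim: m => [//|m IH] /=; rewrite cobd_subdiv IH. Qed.

Lemma iter_subdiv_antip m f : iter m subdiv (antip f) = antip (iter m subdiv f).
Proof. by elim: m => [//|m IH] /=; rewrite IH subdiv_antip. Qed.

Lemma iter_subdivD m f g s :
  iter m subdiv (fun t => f t (+) g t) s =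
  iter m subdiv f s (+) iter m subdiv g s.
Proof.
elim: m s => [//|m IH] s /=; rewrite -subdivnD; congr subdivn.
by apply/funext => t; exact: IH.
Qed.

Lemma iter_subdiv_false m : iter m subdiv (fun=> false) = (fun=> false).
Proof.
elim: m => [//|m IH]; rewrite iterS IH; apply/funext => s; rewrite /subdiv.
move: (size s) => n; elim: n s => [//|n IHn] t /=.
by rewrite -[RHS](cobd_false t); apply: eq_cobd => u _ _; exact: IHn.
Qed.

Lemma subdiv1 f v : subdiv f [:: v] = f [:: v].
Proof. by rewrite /subdiv /= addbF /barycenter /= big_seq1 invr1 scale1r. Qed.

Lemma iter_subdiv1 m f v : iter m subdiv f [:: v] = f [:: v].
Proof. by elim: m => [//|m IH] /=; rewrite subdiv1. Qed.

(* A weak form of convexity, sufficient to localise barycentric subdivisions. *)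
Definition avg_closed (P : V -> Prop) :=
  forall s, s != [::] -> {in s, forall v, P v} -> P (barycenter s).

Lemma sub_barycenter s c : s != [::] ->
  barycenter s - c = (size s)%:R^-1 *: \sum_(v <- s) (v - c).
Proof.
move=> s0; rewrite sumrB /barycenter scalerBr; congr (_ - _).
rewrite big_const_seq count_predT iter_addr addr0 -[c *+ _]scaler_nat scalerA mulVf ?scale1r//.
by rewrite pnatr_eq0 size_eq0.
Qed.

Lemma avg_closed_ball (c : V) r : avg_closed (fun x => `|x - c| <= r).
Proof.
move=> s s0 sP; rewrite sub_barycenter// normrZ normfV normr_nat.
rewrite ler_pdivrMl ?ltr0n ?lt0n ?size_eq0//.
apply: le_trans (ler_norm_sum _ _ _) _.
apply: (@le_trans _ _ (\sum_(v <- s) r)).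
  by rewrite big_seq [leRHS]big_seq; apply: ler_sum => v /sP.
by rewrite big_const_seq count_predT iter_addr addr0 mulr_natl.
Qed.

Definition mesh_le s (D : R) := {in s &, forall x y, `|x - y| <= D}.

(** In the average of the differences [v - c] the term [v = c] vanishes, which leaves [size s - 1]
    terms of norm at most [D]. *)
Lemma barycenter_dist s D c : c \in s -> mesh_le s D ->
  `|c - barycenter s| <= (1 - (size s)%:R^-1) * D.
Proof.
move=> cs sD.
have s0 : s != [::] by apply: contraTneq cs => ->.
have n0 : (size s)%:R != 0 :> R by rewrite pnatr_eq0 size_eq0.
rewrite distrC sub_barycenter// normrZ normfV normr_nat.
rewrite ler_pdivrMl ?ltr0n ?lt0n ?size_eq0//.
rewrite mulrA mulrBr mulr1 divff// (perm_big _ (perm_to_rem cs)) big_cons subrr /= add0r.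
apply: le_trans (ler_norm_sum _ _ _) _.
apply: (@le_trans _ _ (\sum_(v <- rem c s) D)).
  rewrite big_seq [leRHS]big_seq; apply: ler_sum => v /mem_rem vs.
  exact: sD.
rewrite big_const_seq count_predT iter_addr addr0 size_rem// -[D *+ _]mulr_natl.
by rewrite -subn1 natrB// lt0n size_eq0.
Qed.

(** The transposed form of two facts: simplices of the subdivision have smaller mesh and stay in
    every averaging-closed set containing the vertices of [s]. [N] is fixed through the induction on
    faces, so that the shrinking factor is uniform. *)
Lemma eq_subdivn n N D f g s : size s = n -> (n <= N.+1)%N -> 0 <= D ->
    mesh_le s D ->
    (forall t, size t = n -> mesh_le t ((1 - N.+1%:R^-1) * D) ->
      (forall P, avg_closed P -> {in s, forall v, P v} -> {in t, forall v, P v}) ->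
      f t = g t) ->
  subdivn n f s = subdivn n g s.
Proof.
elim: n f g s => [|n IH] f g s sn nN D0 sD fg; first by apply: fg.
have s0 : s != [::] by rewrite -size_eq0 sn.
apply: eq_cobd => t; rewrite sn => -[tn] ts; apply: IH => //.
- exact: ltnW.
- by move=> x y /ts xs /ts ys; exact: sD.
move=> u un uD tu; apply: fg => [|x y|P aP sP x].
- by rewrite /= un.
(* A closed ball about the barycenter of [s] is closed under averages, so it contains [u] as soon as
   it contains the vertices of [t]. *)
- have bD z : z \in u -> `|z - barycenter s| <= (1 - N.+1%:R^-1) * D.
    move=> zu; pose P := fun x : V => `|x - barycenter s| <= (1 - N.+1%:R^-1) * D.
    apply: (tu P) zu => [|v /ts vs]; first exact: avg_closed_ball.
    apply: le_trans (barycenter_dist vs sD) _.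
    by rewrite ler_wpM2r// lerB// sn lef_pV2 ?posrE ?ltr0n// ler_nat.
  rewrite !in_cons => /predU1P[->|xu] /predU1P[->|yu].
  + by rewrite subrr normr0 mulr_ge0// subr_ge0 invf_le1// ler1n.
  + by rewrite distrC bD.
  + exact: bD.
  + exact: uD.
rewrite in_cons => /predU1P[->|]; first exact: aP.
by apply: tu => // v /ts; exact: sP.
Qed.

Lemma eq_iter_subdiv m N D P f g s : (size s <= N.+1)%N -> 0 <= D ->
    mesh_le s D -> avg_closed P -> {in s, forall v, P v} ->
    (forall t, size t = size s -> mesh_le t ((1 - N.+1%:R^-1) ^+ m * D) ->
      {in t, forall v, P v} -> f t = g t) ->
  iter m subdiv f s = iter m subdiv g s.
Proof.
elim: m f g => [|m IH] f g sN D0 sD aP sP fg.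
  by apply: fg => //; rewrite expr0 mul1r.
rewrite !iterSr; apply: IH => // t ts tD tP.
rewrite /subdiv; apply: (eq_subdivn (N := N) (erefl _) _ _ tD); first by rewrite ts.
  by rewrite mulr_ge0// exprn_ge0// subr_ge0 invf_le1// ler1n.
move=> u ut uD tu; apply: fg; first by rewrite ut.
  by rewrite exprS -mulrA.
exact: (tu P).
Qed.
End Subdivision.

(** * The Borsuk-Ulam theorem *)

Lemma continuous_sum (R : realType) (T : topologicalType) (I : Type) (r : seq I)
    (f : I -> T -> R) (x : T) :
    (forall i, {for x, continuous (f i)}) ->
  {for x, continuous (fun y => \sum_(i <- r) f i y)}.
Proof.
move=> cf; elim: r => [|i r IH].
  have -> : (fun y => \sum_(i <- [::]) f i y) = cst 0.
    by apply/funext => y; rewrite big_nil.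
  exact: cst_continuous.
have -> : (fun y => \sum_(j <- i :: r) f j y) = f i \+ (fun y => \sum_(j <- r) f j y).
  by apply/funext => y; rewrite big_cons.
exact: continuousD (cf i) IH.
Qed.

(** * The cross-polytope and its fine subdivisions *)

Section CrossPolytope.
Variables (R : realType) (n : nat).
Local Notation V := 'rV[R]_n.+1.
Implicit Types (x y : V) (eps : 'I_n.+1 -> bool).

Definition crosspolytope : set V := [set x | \sum_j `|x ord0 j| = 1].

(** Linear conditions, so averages stay inside; this fails for [crosspolytope] as a whole. *)
Definition facet eps : set V := [set x |
  \sum_j (-1) ^+ eps j * x ord0 j = 1 /\ forall j, 0 <= (-1) ^+ eps j * x ord0 j].

Lemma facet_crosspolytope eps : facet eps `<=` crosspolytope.
Proof.
move=> x [sx x0]; rewrite /crosspolytope /= -sx; apply: eq_bigr => j _.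
by rewrite -[RHS]ger0_norm// normrM normrX normrN1 expr1n mul1r.
Qed.

Lemma crosspolytope_norm x : crosspolytope x -> `|x| <= 1.
Proof.
move=> x1; rewrite [leLHS]mx_normrE; apply: bigmax_le => //= -[i j] _ /=.
rewrite ord1 -x1 (bigD1 j)//= lerDl sumr_ge0//.
Qed.

Lemma crosspolytope_neq0 x : crosspolytope x -> x != 0.
Proof.
move=> x1; apply/eqP => x0; move: x1; rewrite /crosspolytope /= x0.
rewrite big1 => [/esym/eqP|j _]; first by rewrite oner_eq0.
by rewrite mxE normr0.
Qed.

Lemma compact_crosspolytope : compact crosspolytope.
Proof.
apply: bounded_closed_compact.
  exists 1; split; first exact: real1.
  by move=> M M1 x /crosspolytope_norm x1 /=; exact: le_trans x1 (ltW M1).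
have -> : crosspolytope = (fun x : V => \sum_j `|x ord0 j|) @^-1` [set 1] by [].
apply: preimage_closed; last exact: closed_eq.
move=> x _; apply: continuous_sum => j.
apply: (continuous_comp (f := fun x : V => x ord0 j)).
  exact: coord_continuous.
exact: norm_continuous.
Qed.

Lemma facet_avg_closed eps : avg_closed (facet eps).
Proof.
move=> s s0 sP.
have n0 : (size s)%:R != 0 :> R by rewrite pnatr_eq0 size_eq0.
have bE j : (-1) ^+ eps j * barycenter s ord0 j =
    (size s)%:R^-1 * \sum_(v <- s) (-1) ^+ eps j * v ord0 j.
  by rewrite mxE summxE mulrCA mulr_sumr.
split; last first.
  move=> j; rewrite bE mulr_ge0 ?invr_ge0// big_seq sumr_ge0// => v /sP [_]; exact.
under eq_bigr do rewrite bE.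
rewrite -mulr_sumr exchange_big /= big_seq (eq_bigr (fun=> 1)).
  by rewrite -big_seq big_const_seq count_predT iter_addr addr0 mulVf.
by move=> v /sP [].
Qed.

Lemma vertices_facet eps (js : seq 'I_n.+1) :
  {in vertices (fun j => delta_mx ord0 j : V) eps js, forall v, facet eps v}.
Proof.
move=> v /mapP[j _ ->].
have sE i : (-1) ^+ eps i *
    (if eps j then - delta_mx ord0 j : V else delta_mx ord0 j) ord0 i = (i == j)%:R.
  have [->|ij] := eqVneq i j.
    by case: (eps j); rewrite !mxE !eqxx/= ?expr1 ?mulrNN mulr1.
  by case: (eps j); rewrite !mxE (negbTE ij) andbF/= ?oppr0 mulr0.
split => [|i]; last by rewrite sE.
by under eq_bigr do rewrite sE; rewrite (bigD1 j)//= eqxx big1 ?addr0// => i /negbTE ->.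
Qed.

Lemma mesh_vertices eps (js : seq 'I_n.+1) :
  mesh_le (vertices (fun j => delta_mx ord0 j : V) eps js) 2.
Proof.
move=> x y /vertices_facet/facet_crosspolytope/crosspolytope_norm x1.
move=> /vertices_facet/facet_crosspolytope/crosspolytope_norm y1.
by apply: le_trans (ler_normB _ _) _; rewrite -[2]/(1 + 1) lerD.
Qed.

(** The parity count. Writing [signcup (a :: ss)] as a coboundary, Stokes moves it to the lower
    hemisphere, where it appears with its antipode; by oddness the sum is [signcup ss]. A single
    vertex remains at the end, with value 1. *)
Lemma hemi_iter_signcup m j0 js (ss : seq (V -> bool)) :
    uniq (rcons js j0) -> size ss = size js ->
    (forall v, crosspolytope v -> all (fun a : V -> bool => a (- v) == ~~ a v) ss) ->
  hemi (delta_mx ord0 j0) [seq delta_mx ord0 j | j <- js]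
    (iter m (@subdiv R V) (signcup ss)).
Proof.
elim: js ss => [|j js IH] [|a ss]//.
  by rewrite /= iter_subdiv1.
rewrite rcons_cons cons_uniq => /andP[_ ujs] [ssjs] odd_ss.
have odd_ss' v : crosspolytope v -> all (fun a : V -> bool => a (- v) == ~~ a v) ss.
  by move=> /odd_ss /andP[].
rewrite map_cons -cobd_cup0_signcup -iter_cobd_subdiv hemi_cobd -iter_subdiv_antip -hemiD.
rewrite /is_true -[RHS](IH ss ujs ssjs odd_ss').
apply: (eq_hemi (e := fun j => delta_mx ord0 j : V)) => // eps.
rewrite -iter_subdivD.
apply: (eq_iter_subdiv (N := size js) _ _ (@mesh_vertices eps _)
  (@facet_avg_closed eps) (@vertices_facet eps _)) => //.
  by rewrite size_map size_rcons.
move=> t _ _ tP; apply: antip_cup0 => v /tP /facet_crosspolytope; exact: odd_ss.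
Qed.

(** Otherwise [signcup] would agree with the zero cochain on all simplices of a fine enough
    subdivision, and its value on the hemisphere would be 0, not 1. *)
Lemma fine_sign_change (a : 'I_n -> V -> bool) d : 0 < d ->
    (forall i v, crosspolytope v -> a i (- v) = ~~ a i v) ->
  exists t : seq V, [/\ {in t, forall v, crosspolytope v}, mesh_le t d &
    signcup [seq a i | i <- enum 'I_n] t].
Proof.
move=> d0 odd_a; apply: contrapT => nex.
pose r : R := 1 - n.+1%:R^-1.
have r01 : 0 <= r < 1.
  by rewrite subr_ge0 invf_le1 ?ltr0n// ler1n /= ltrBlDr ltrDl invr_gt0 ltr0n.
have [m rm] : exists m, r ^+ m * 2 <= d.
  have r1 : `|r| < 1 by rewrite ger0_norm; case/andP: r01.
  have /cvgr0Pnorm_le /(_ _ d0) [m _ /(_ m (leqnn m))] := cvg_geometric (2 : R) r1.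
  by move=> /(le_trans (ler_norm _)) rm; exists m; rewrite mulrC.
(* [ord0] gives the base point, and the other [n] axes give one cone apex for each function
   [a i]. *)
pose js := [seq lift ord0 i | i <- enum 'I_n].
have ujs : uniq (rcons js ord0).
  rewrite rcons_uniq map_inj_uniq ?enum_uniq ?andbT; last exact: lift_inj.
  by apply/mapP => -[i _ /eqP]; rewrite (negbTE (neq_lift _ _)).
have : hemi (delta_mx ord0 ord0) [seq delta_mx ord0 j | j <- js]
    (iter m (@subdiv R V) (signcup [seq a i | i <- enum 'I_n])).
  apply: hemi_iter_signcup => //; first by rewrite !size_map.
  by move=> v v1; apply/allP => _ /mapP[i _ ->]; rewrite odd_a.
suff -> : hemi (delta_mx ord0 ord0) [seq delta_mx ord0 j | j <- js]
    (iter m (@subdiv R V) (signcup [seq a i | i <- enum 'I_n])) = false by [].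
rewrite -[RHS](@hemi_false V (delta_mx ord0 ord0) [seq delta_mx ord0 j | j <- js]).
rewrite -(iter_subdiv_false V m).
apply: (eq_hemi (e := fun j => delta_mx ord0 j : V)) => // eps.
apply: (eq_iter_subdiv (N := n) _ _ (@mesh_vertices eps _)
  (@facet_avg_closed eps) (@vertices_facet eps _)) => //.
  by rewrite size_map size_rcons size_map size_enum_ord.
move=> t _ tr tP; apply/negbTE/negP => at_; apply: nex; exists t; split => //.
  by move=> v /tP /facet_crosspolytope.
by move=> x y xt yt; apply: le_trans (tr _ _ xt yt) rm.
Qed.
End CrossPolytope.

Section BorsukUlam.
Variables (R : realType) (n : nat).
Local Notation V := 'rV[R]_n.+1.

(* Breaks ties, so that the signs are odd even where [h] vanishes. *)
Definition lead_pos (v : V) : bool :=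
  if [pick j | v ord0 j != 0] is Some j then 0 < v ord0 j else false.

Lemma lead_posN (v : V) : v != 0 -> lead_pos (- v) = ~~ lead_pos v.
Proof.
move=> v0; rewrite /lead_pos.
rewrite (@eq_pick _ (fun j => (- v) ord0 j != 0) (fun j => v ord0 j != 0)); last first.
  by move=> j /=; rewrite mxE oppr_eq0.
case: pickP => [j vj|v00].
  by rewrite mxE oppr_gt0 -leNgt le_eqVlt (negbTE vj).
case/negP: v0; apply/eqP/rowP => j; rewrite mxE.
by have /negbFE/eqP := v00 j.
Qed.

(** Stated on nonzero vectors, so that the proof can use the cross-polytope and the application
    round quaternions. *)
Theorem borsuk_ulam (h : 'I_n -> V -> R) :
    (forall i v, v != 0 -> {for v, continuous (h i)}) ->
    (forall i v, v != 0 -> h i (- v) = - h i v) ->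
  exists2 v, v != 0 & forall i, h i v = 0.
Proof.
move=> ch oh.
pose a i v := (0 < h i v) || (h i v == 0) && lead_pos v.
have oa i v : crosspolytope v -> a i (- v) = ~~ a i v.
  move=> /crosspolytope_neq0 v0; rewrite /a oh// lead_posN// oppr_gt0 oppr_eq0.
  by case: ltgtP.
have /choice[t tP] : forall k, exists t : seq V,
    [/\ {in t, forall v, crosspolytope v}, mesh_le t k.+1%:R^-1 &
      signcup [seq a i | i <- enum 'I_n] t].
  by move=> k; apply: fine_sign_change => //; rewrite invr_gt0 ltr0n.
(* The default 0 is never reached: [signcup] vanishes on the empty sequence. *)
pose x k := head 0 (t k).
have xt k : x k \in t k.
  have [_ _] := tP k; rewrite /x; case: (t k) => [|v s _]; first by rewrite signcup_nil.
  exact: mem_head.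
have [q [q1 clq]] : @crosspolytope R n `&` cluster (x @ \oo) !=set0.
  apply: compact_crosspolytope; exists 0%N => // k _ /=.
  by have [+ _ _] := tP k; apply.
have q0 := crosspolytope_neq0 q1.
exists q => // i; apply: contrapT => /eqP hq.
(* If [h i q] were nonzero, [h i] would keep its strict sign near [q]; the product treats both signs
   at once. *)
have : \forall z \near q, 0 < h i z * h i q.
  have c : {for q, continuous (fun z => h i z * h i q)}.
    by apply: continuousM; [exact: ch|exact: cst_continuous].
  by apply: (cvgr_gt _ c); rewrite -expr2 exprn_even_gt0.
move=> /nbhs_ballP[e /= e0 qe].
have [k [/ltW ke ball_k]] : exists k, k.+1%:R^-1 < e / 2 /\ ball q (e / 2) (x k).
  have [N _ Ne] : \forall k \near \oo, k.+1%:R^-1 < e / 2.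
    exact: (near_infty_natSinv_lt (PosNum (divr_gt0 e0 (ltr0n R 2)))).
  have [_ [[k kN <-] xk]] := clq (x @` [set k | (N <= k)%N]) (ball q (e / 2))
    (ex_intro2 _ _ N I (fun k kN => ex_intro2 _ _ k kN erefl))
    (nbhsx_ballx _ _ (divr_gt0 e0 (ltr0n R 2))).
  by exists k; split => //; exact: Ne.
(* [x k] is within [e / 2] of [q] and the mesh of [t k] is at most [e / 2], so all of [t k] lies
   where [h i] has constant sign. *)
have tk z : z \in t k -> 0 < h i z * h i q.
  move=> zt; apply: qe; rewrite -ball_normE /=.
  move: ball_k; rewrite -ball_normE /= => qx.
  rewrite -[q](subrK (x k)) -addrA (le_lt_trans (ler_normD _ _))// [ltRHS]splitr ltr_leD//.
  by have [_ + _] := tP k; move=> /(_ _ _ (xt k) zt)/le_trans; apply.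
have [_ _ /(signcup_sign_change (mem_enum _ i))] := tP k.
move=> [y [z [/tk hy /tk hz]]]; rewrite /a.
case/orP: (lt_total hq) => {}hq; move: hy hz.
  by rewrite !(nmulr_lgt0 _ hq) => hy hz; rewrite (lt_gtF hy) (lt_gtF hz) (lt_eqF hy) (lt_eqF hz).
by rewrite !(pmulr_lgt0 _ hq) => -> ->.
Qed.
End BorsukUlam.

(** * Unit quaternions *)

Section Quaternions.
Variable R : realType.
Implicit Types (p q v : 'rV[R]_4).

Definition qdot p q : R := \sum_j p ord0 j * q ord0 j.

Lemma qdotE p q : qdot p q = qw p * qw q + qx p * qx q + qy p * qy q + qz p * qz q.
Proof.
rewrite /qdot !big_ord_recl big_ord0 addr0 !addrA.
by congr (_ + _ + _ + _); congr (p _ _ * q _ _); apply: val_inj.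
Qed.

Lemma S3E q : S3 q = (qdot q q = 1).
Proof. by rewrite /S3 /qdot /=; under [in LHS]eq_bigr do rewrite expr2. Qed.

Lemma RQN q : RQ (- q) = RQ q.
Proof.
rewrite /RQ; apply/matrixP => i j; rewrite !mxE /qw /qx /qy /qz !mxE.
by rewrite !mulrNN !sqrrN.
Qed.

(* the matrix of v |-> q v q^*, homogeneous in q *)
Definition RQh q : 'M[R]_3 :=
  let w := qw q in let x := qx q in let y := qy q in let z := qz q in
  \matrix_(i < 3, j < 3)
    nth 0 (nth [::]
      [:: [:: w ^+ 2 + x ^+ 2 - y ^+ 2 - z ^+ 2; 2 * (x * y - z * w); 2 * (x * z + y * w)];
          [:: 2 * (x * y + z * w); w ^+ 2 - x ^+ 2 + y ^+ 2 - z ^+ 2; 2 * (y * z - x * w)];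
          [:: 2 * (x * z - y * w); 2 * (y * z + x * w); w ^+ 2 - x ^+ 2 - y ^+ 2 + z ^+ 2]]
      i) j.

(** Turns later facts about rotations into polynomial identities that hold for all quaternions and
    are left to [ring]. *)
Lemma RQ_homogeneous q : S3 q -> RQ q = RQh q.
Proof.
rewrite S3E qdotE => q1; apply/matrixP => i j; rewrite !mxE.
have -> : qw q ^+ 2 = 1 - qx q ^+ 2 - qy q ^+ 2 - qz q ^+ 2 by rewrite -q1; ring.
by case: i => [[|[|[|//]]] ?]; case: j => [[|[|[|//]]] ?] //=; ring.
Qed.

(** With t the relative rotation angle this is 1 + 2 cos t, where [qdot p q] is cos(t/2) up to sign;
    orthogonality thus means angle [pi]. *)
Lemma tr_RQ p q : S3 p -> S3 q -> \tr (RQ p *m (RQ q)^T) = 4 * qdot p q ^+ 2 - 1.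
Proof.
move=> p1 q1; transitivity (4 * qdot p q ^+ 2 - qdot p p * qdot q q); last first.
  by move: p1 q1; rewrite !S3E => -> ->; rewrite mulr1.
rewrite !RQ_homogeneous// /mxtrace !big_ord_recl big_ord0.
by rewrite !mxE !big_ord_recl !big_ord0 !mxE /= !qdotE; ring.
Qed.

(** For any [q], [RQh q] times its transpose is [qdot q q ^+ 2] times the identity, and its
    determinant is [qdot q q ^+ 3]. *)
Lemma RQ_SO3 q : S3 q -> SO3 (RQ q).
Proof.
move=> q1; rewrite RQ_homogeneous//; split.
  apply/matrixP => i j; rewrite !mxE !big_ord_recl !big_ord0 !mxE.
  have -> : (i == j)%:R = qdot q q ^+ 2 *+ (i == j).
    by move: q1; rewrite S3E => ->; rewrite expr1n.
  rewrite qdotE.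
  by case: i => [[|[|[|//]]] ?]; case: j => [[|[|[|//]]] ?] //=; ring.
transitivity (qdot q q ^+ 3); last by move: q1; rewrite S3E => ->; rewrite expr1n.
rewrite !(expand_det_row _ ord0) !big_ord_recl !big_ord0 /cofactor.
rewrite !(expand_det_row _ ord0) !big_ord_recl !big_ord0 /cofactor !det_mx11 !mxE /=.
by rewrite qdotE; ring.
Qed.

Lemma rot_dist_RQ_orthogonal p q : S3 p -> S3 q -> qdot p q = 0 ->
  rot_dist (RQ q) (RQ p) = pi.
Proof.
move=> p1 q1 pq; have [qqT _] := RQ_SO3 q1.
have qu : RQ q \in unitmx by case: (mulmx1_unit qqT).
have invE : invmx (RQ q) = (RQ q)^T by rewrite -[LHS]mulmx1 -qqT mulKmx.
rewrite /rot_dist invE tr_RQ// pq expr0n /= mulr0 sub0r -acosN1; congr acos.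
by lra.
Qed.

Definition qnorm v : R := Num.sqrt (qdot v v).
Definition qnormalize v := (qnorm v)^-1 *: v.

Lemma qdot_gt0 v : v != 0 -> 0 < qdot v v.
Proof.
move=> v0; rewrite lt_neqAle eq_sym; apply/andP; split; last first.
  by apply: sumr_ge0 => j _; rewrite -expr2 sqr_ge0.
apply: contra v0; rewrite psumr_eq0 => [/allP v0|j _]; last by rewrite -expr2 sqr_ge0.
apply/eqP/rowP => j; rewrite mxE; apply/eqP.
by rewrite -(orbb (_ == 0)) -mulf_eq0; apply: v0; rewrite mem_index_enum.
Qed.

Lemma qnormalize_S3 v : v != 0 -> S3 (qnormalize v).
Proof.
move=> /qdot_gt0 v0; rewrite S3E; transitivity ((qnorm v) ^- 2 * qdot v v).
  by rewrite /qdot mulr_sumr; apply: eq_bigr => j _; rewrite !mxE mulrACA -exprVn expr2.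
by rewrite sqr_sqrtr ?ltW// mulVf// gt_eqF.
Qed.

Lemma qnormalizeN v : qnormalize (- v) = - qnormalize v.
Proof.
rewrite /qnormalize scalerN /qnorm; congr (- ((Num.sqrt _)^-1 *: _)).
by apply: eq_bigr => j _; rewrite !mxE mulrNN.
Qed.

Lemma continuous_mx (T : topologicalType) m n (g : T -> 'M[R]_(m, n)) (x : T) :
    (forall i j, {for x, continuous (fun y => g y i j)}) ->
  {for x, continuous g}.
Proof.
move=> cg; apply/cvgrPdist_lt => e e0.
have : \forall y \near x, forall ij : 'I_m * 'I_n,
    `|g x ij.1 ij.2 - g y ij.1 ij.2| < e.
  apply: filter_forall => -[i j]; by have /cvgrPdist_lt := cg i j; apply.
apply: filterS => y gxy.
rewrite [ltLHS]mx_normrE; apply: bigmax_lt => // ij _.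
by rewrite !mxE; exact: gxy.
Qed.

Lemma continuous_qdot (T : topologicalType) (f g : T -> 'rV[R]_4) (x : T) :
    {for x, continuous f} -> {for x, continuous g} ->
  {for x, continuous (fun y => qdot (f y) (g y))}.
Proof.
move=> cf cg; apply: continuous_sum => j.
have cj (k : T -> 'rV[R]_4) : {for x, continuous k} ->
    {for x, continuous (fun y => k y ord0 j)}.
  move=> ck; apply: (continuous_comp (g := fun p : 'rV[R]_4 => p ord0 j) ck).
  exact: coord_continuous.
exact: continuousM (cj _ cf) (cj _ cg).
Qed.

Lemma continuous_qnormalize v : v != 0 -> {for v, continuous qnormalize}.
Proof.
move=> v0; apply: (@continuousZ _ _ _ (fun w => (qnorm w)^-1) id).
  apply: continuousV; first by rewrite gt_eqF// sqrtr_gt0 qdot_gt0.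
  apply: (continuous_comp (f := fun w => qdot w w)); last exact: sqrt_continuous.
  by apply: continuous_qdot => ?.
by move=> ?.
Qed.

Lemma continuous_RQ : continuous (@RQ R).
Proof.
move=> q; have coord k : {for q, continuous (fun p : 'rV[R]_4 => p ord0 k)}.
  exact: coord_continuous.
have diag k l : {for q, continuous (fun p : 'rV[R]_4 =>
    1 - 2 * p ord0 k ^+ 2 - 2 * p ord0 l ^+ 2)}.
  have sq j : {for q, continuous (fun p : 'rV[R]_4 => 2 * p ord0 j ^+ 2)}.
    apply: continuousM; first exact: cst_continuous.
    exact: continuousM (coord j) (coord j).
  apply: continuousB; last exact: sq.
  by apply: continuousB; [exact: cst_continuous|exact: sq].
have addM i j k l : {for q, continuous (fun p : 'rV[R]_4 =>
    2 * (p ord0 i * p ord0 j + p ord0 k * p ord0 l))}.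
  apply: continuousM; first exact: cst_continuous.
  exact: continuousD (continuousM (coord i) (coord j)) (continuousM (coord k) (coord l)).
have subM i j k l : {for q, continuous (fun p : 'rV[R]_4 =>
    2 * (p ord0 i * p ord0 j - p ord0 k * p ord0 l))}.
  apply: continuousM; first exact: cst_continuous.
  exact: continuousB (continuousM (coord i) (coord j)) (continuousM (coord k) (coord l)).
apply: continuous_mx => i j.
rewrite (_ : (fun p => RQ p i j) = fun p => nth 0 (nth [::]
  [:: [:: 1 - 2 * qy p ^+ 2 - 2 * qz p ^+ 2; 2 * (qx p * qy p - qz p * qw p);
          2 * (qx p * qz p + qy p * qw p)];
      [:: 2 * (qx p * qy p + qz p * qw p); 1 - 2 * qx p ^+ 2 - 2 * qz p ^+ 2;
          2 * (qy p * qz p - qx p * qw p)];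
      [:: 2 * (qx p * qz p - qy p * qw p); 2 * (qy p * qz p + qx p * qw p);
          1 - 2 * qx p ^+ 2 - 2 * qy p ^+ 2]] i) j); last first.
  by apply/funext => p; rewrite mxE.
by case: i => [[|[|[|//]]] ?]; case: j => [[|[|[|//]]] ?] /=;
  [exact: diag|exact: subM|exact: addM|exact: addM|exact: diag|exact: subM
  |exact: subM|exact: addM|exact: diag].
Qed.

(** [f] is continuous only relative to [SO3], but all nonzero vectors near [v] are mapped into
    [SO3], so the composite is continuous in the full sense. *)
Lemma continuous_pullback (f : 'M[R]_3 -> 'rV[R]_4) v :
    {within SO3, continuous f} -> v != 0 ->
  {for v, continuous (fun w => qdot (qnormalize w) (f (RQ (qnormalize w))))}.
Proof.
move=> /subspace_continuousP cf v0; have cn := continuous_qnormalize v0.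
apply: continuous_qdot => //.
have SO3v w : w != 0 -> SO3 (RQ (qnormalize w)) by move=> /qnormalize_S3/RQ_SO3.
have cRQ : {for v, continuous (fun w => RQ (qnormalize w))}.
  by apply: continuous_comp cn _; exact: continuous_RQ.
move=> A nA; have := cRQ _ (cf _ (SO3v _ v0) A nA).
apply: filterS2 (cvgr_neq0 _ (@cvg_id _ (nbhs v)) v0) => w w0.
by apply; exact: SO3v.
Qed.
End Quaternions.

(** * Three maps from rotations to quaternions *)

Unset Implicit Arguments.
Set Strict Implicit.

Theorem theorem5 (R : realType) (f1 f2 f3 : 'M[R]_3 -> 'rV[R]_4) :
  {within (@SO3 R), continuous f1} ->
  {within (@SO3 R), continuous f2} ->
  {within (@SO3 R), continuous f3} ->
  f1 @` SO3 `<=` S3 -> f2 @` SO3 `<=` S3 -> f3 @` SO3 `<=` S3 ->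
  exists M : 'M[R]_3, SO3 M /\
    rot_dist M (RQ (f1 M)) = pi /\
    rot_dist M (RQ (f2 M)) = pi /\
    rot_dist M (RQ (f3 M)) = pi.
Proof.
move=> c1 c2 c3 s1 s2 s3.
pose f (i : 'I_3) := nth f1 [:: f1; f2; f3] i.
pose h i (v : 'rV[R]_4) := qdot (qnormalize v) (f i (RQ (qnormalize v))).
have cf i : {within SO3, continuous f i} by case: i => [[|[|[|//]]] ?].
have [i v v0|i v v0|v v0 hv] := @borsuk_ulam R 3 h.
- exact: continuous_pullback.
(* Oddness: [q] and [- q] give the same rotation, so only the first factor changes sign. *)
- rewrite /h qnormalizeN RQN /qdot -sumrN.
  by apply: eq_bigr => j _; rewrite mxE mulNr.
have q1 := qnormalize_S3 v0; have M1 := RQ_SO3 q1.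
have fS i : S3 (f i (RQ (qnormalize v))).
  by case: i => [[|[|[|//]]] ?]; [apply: s1|apply: s2|apply: s3]; exists (RQ (qnormalize v)).
have dist i : rot_dist (RQ (qnormalize v)) (RQ (f i (RQ (qnormalize v)))) = pi.
  apply: rot_dist_RQ_orthogonal => //; rewrite -[RHS](hv i).
  by apply: eq_bigr => j _; rewrite mulrC.
exists (RQ (qnormalize v)); split => //; split; last split.
- exact: (dist (Ordinal (isT : (0 < 3)%N))).
- exact: (dist (Ordinal (isT : (1 < 3)%N))).
- exact: (dist (Ordinal (isT : (2 < 3)%N))).
Qed.
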